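(* Let $n^\ast(d,\varepsilon)$ denote the inverse of the star discrepancy, and let $p^\ast$ and $q^\ast$ be its accuracy exponent and dimension exponent, as defined in the context. Then $$p^{\ast}=2\qquad\text{and}\qquad q^{\ast}=1.$$ Consequently, the powers $2$ of $\varepsilon^{-1}$ and $1$ of $d$ in the upper bound $n^{\ast}(d,\varepsilon)\le C\,d\,\varepsilon^{-2}$ (valid with an absolute constant $C>0$ for all $d\in\mathbb{N}$ and $0<\varepsilon<1$) are individually optimal; that is, if for some $C>0$, $p,q\ge0$ and $\varepsilon_1>0$ one has $n^{\ast}(d,\varepsilon)\le C d^q\varepsilon^{-p}$ for all $d\in\mathbb{N}$ and all $0<\varepsilon\le\varepsilon_1$, then $p\ge2$ and $q\ge1$.
   Context: Here $\mathbb{N}=\{1,2,3,\dots\}$. For $d\in\mathbb{N}$ and $y=(y_1,\dots,y_d)\in[0,1]^d$, write $[0,y):=\prod_{j=1}^d[0,y_j)$, let $\mathbf{1}_{[0,y)}$ be its indicator function and $\operatorname{vol}([0,y))=\prod_{j=1}^d y_j$ its Lebesgue measure. For an $N$-point multiset $P=\{x_1,\dots,x_N\}\subset[0,1)^d$ (points may be repeated and are counted with multiplicity), the star discrepancy is $$D_N^{\ast}(P):=\sup_{y\in[0,1]^d}\left|\frac1N\sum_{n=1}^N\mathbf{1}_{[0,y)}(x_n)-\operatorname{vol}([0,y))\right|.$$ The minimal star discrepancy is $D^{\ast}(N,d):=\inf_{P\subset[0,1)^d,\ |P|=N}D_N^{\ast}(P)$, the infimum being over all $N$-point multisets, and the inverse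 of the star discrepancy is $$n^{\ast}(d,\varepsilon):=\min\{N\in\mathbb{N}: D^{\ast}(N,d)\le\varepsilon\}.$$ The accuracy exponent $p^\ast$ is the infimum of all real $p\ge0$ for which there exist $C>0$, $q\ge0$ and $\varepsilon_1>0$ such that $n^{\ast}(d,\varepsilon)\le C d^q\varepsilon^{-p}$ for all $d\in\mathbb{N}$ and all $0<\varepsilon\le\varepsilon_1$. The dimension exponent $q^\ast$ is the infimum of all real $q\ge0$ for which there exist $C>0$, $p\ge0$ and $\varepsilon_1>0$ such that $n^{\ast}(d,\varepsilon)\le C d^q\varepsilon^{-p}$ for all $d\in\mathbb{N}$ and all $0<\varepsilon\le\varepsilon_1$. *)

(* Defs.v *)
From HB Require Import structures.
From mathcomp Require Import all_boot all_order all_algebra.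
From mathcomp Require Import all_classical all_reals all_analysis.

Set Implicit Arguments.
Unset Strict Implicit.
Unset Printing Implicit Defensive.

Import Order.TTheory GRing.Theory Num.Theory.

Local Open Scope classical_set_scope.
Local Open Scope ring_scope.

Definition closed_cube (R : realType) (d : nat) : set 'rV[R]_d :=
  [set y | forall j, 0 <= y 0 j <= 1].

Definition halfopen_cube (R : realType) (d : nat) : set 'rV[R]_d :=
  [set x | forall j, 0 <= x 0 j < 1].

Definition anchored_box (R : realType) (d : nat) (y : 'rV[R]_d) :
    set 'rV[R]_d :=
  [set x | forall j, 0 <= x 0 j < y 0 j].

Definition box_vol (R : realType) (d : nat) (y : 'rV[R]_d) : R :=
  \prod_(j < d) y 0 j.

(* An N-point multiset is enumerated by a family indexed by 'I_N, so that
   repeated points are counted with multiplicity. *)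
Definition star_discrepancy (R : realType) (d N : nat)
    (x : 'I_N -> 'rV[R]_d) : R :=
  sup [set `| N%:R^-1 * (\sum_(n < N) \1_(anchored_box y) (x n)) - box_vol y |
      | y in @closed_cube R d].

Definition min_star_discrepancy (R : realType) (N d : nat) : R :=
  inf [set star_discrepancy x
      | x in [set x : 'I_N -> 'rV[R]_d | forall n, halfopen_cube (x n)]].

(* The minimum of a set of natural numbers, with min(set0) = +oo. *)
Definition nat_min (R : realType) (A : set nat) : \bar R :=
  match pselect (exists N, `[< A N >]) with
  | left exA => (ex_minn exA)%:R%:E
  | right _ => +oo%E
  end.

Definition inverse_star_discrepancy (R : realType) (d : nat) (eps : R) :
    \bar R :=
  nat_min R [set N | (0 < N)%N /\ min_star_discrepancy R N d <= eps].

Definition inverse_bound (R : realType) (C p q eps1 : R) : Prop :=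
  forall (d : nat) (eps : R), (0 < d)%N -> 0 < eps <= eps1 ->
    (inverse_star_discrepancy d eps <= (C * d%:R `^ q * eps `^ (- p))%:E)%E.

(* In both exponents, [inf] is the infimum in R, which the library sets to 0
   on the empty set; a nonzero value therefore certifies nonemptiness. *)
Definition accuracy_exponent (R : realType) : R :=
  inf [set p : R | 0 <= p /\ exists C q eps1 : R,
    [/\ 0 < C, 0 <= q, 0 < eps1 & inverse_bound C p q eps1]].

Definition dimension_exponent (R : realType) : R :=
  inf [set q : R | 0 <= q /\ exists C p eps1 : R,
    [/\ 0 < C, 0 <= p, 0 < eps1 & inverse_bound C p q eps1]].

(* Main.v *)
(** Lower bound on [p]: for a set [S] of coordinates let [chi_S] be the Rademacher
    parity on [S].  At [N] points the [M] parities with [#|S| = k] give [N] sign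
    vectors of length [M]; comparing the two ways of summing the squares of their
    inner products shows that, if [2 N <= M], two distinct parities [chi_S],
    [chi_T] correlate by at least [(2 N)^(-1/2)].  Their product is a nontrivial
    parity on at most [2k] coordinates, hence a combination of boxes with total
    weight at most [9^k], so the star discrepancy is at least
    [9^(-k) (2 N)^(-1/2)] as soon as [2 N <= 'C(d, k)].  With [d] of order
    [N^(1/k)] and [k] large this forces [p >= 2].

    Lower bound on [q]: shrink the sides in [S] from [1] to [1 - 1/(2d)].  If two of
    these [2^d] boxes catch the same points, so does their intersection, whose
    volume is smaller by order [#|T \ S| / d]; for small discrepancy [S] and [T]
    are then close in Hamming distance.  Hence the [2^N] possible traces are
    shared by Hamming balls only and [N] is at least linear in [d].

    Upper bound: chaining over bracketing covers at the scales [4^-k], which have at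
    most [64^(k d)] members, applied to random points of a fine grid.  The deviations
    at all scales are controlled at once by averaging exponential moments, and the
    chain stops at scale [4^-K ~ eps], where a bracket pins down every box. *)

Require Import Defs.
From HB Require Import structures.
From mathcomp Require Import all_boot all_order all_algebra.
From mathcomp Require Import all_classical all_reals all_analysis.
From mathcomp Require Import ring lra zify.

Set Implicit Arguments.
Unset Strict Implicit.
Unset Printing Implicit Defensive.

Import Order.TTheory GRing.Theory Num.Theory.

Local Open Scope ring_scope.

(** * Boxes, empirical frequencies and the inverse of the discrepancy *)

Lemma prod_bool (R : pzSemiRingType) (I : finType) (P : pred I) :
  \prod_i (P i)%:R = [forall i, P i]%:R :> R.
Proof.
rewrite -(big_morph _ (@natrM R) (erefl 1%:R)); congr _%:R.
case: (boolP [forall i, P i]) => [/forallP h|].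
  by rewrite big1 // => i _; rewrite h.
rewrite negb_forall => /existsP[i /negbTE hi].
by rewrite (bigD1 i) //= hi mul0n.
Qed.

Lemma box_vol01 (R : realType) (d : nat) (y : 'rV[R]_d) :
  closed_cube y -> 0 <= box_vol y <= 1.
Proof.
move=> hy; rewrite /box_vol; apply/andP; split.
  by apply: prodr_ge0 => j _; case/andP: (hy j).
by apply: prodr_ile1 => j _; apply: hy.
Qed.

Lemma indic_box (R : realType) (d : nat) (x y : 'rV[R]_d) :
  halfopen_cube x ->
  \1_(anchored_box y) x = \prod_(j < d) (x 0 j < y 0 j)%R%:R :> R.
Proof.
move=> hx; rewrite indicE prod_bool; congr ((nat_of_bool _)%:R).
apply/idP/idP.
  by rewrite inE => h; apply/forallP => j; case/andP: (h j).
move=> /forallP h; rewrite inE => j; rewrite h andbT.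
by case/andP: (hx j).
Qed.

Definition box_freq (R : realType) (d N : nat) (x : 'I_N -> 'rV[R]_d)
    (y : 'rV[R]_d) : R :=
  N%:R^-1 * \sum_(n < N) \1_(anchored_box y) (x n).

Lemma mean_ge0 (R : realFieldType) (I : finType) (n : nat) (f : I -> R) :
  (forall i, 0 <= f i) -> 0 <= n%:R^-1 * \sum_i f i.
Proof. by move=> hf; rewrite mulr_ge0 ?invr_ge0 // sumr_ge0. Qed.

Lemma mean_norm_le (R : realFieldType) (N : nat) (f : 'I_N -> R) (c : R) :
  0 <= c -> (forall i, `|f i| <= c) -> `|N%:R^-1 * \sum_i f i| <= c.
Proof.
move=> c0 hf; case: N => [|N] in f hf *; first by rewrite big_ord0 mulr0 normr0.
rewrite normrM ger0_norm ?invr_ge0 // mulrC ler_pdivrMr //.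
apply: le_trans (ler_norm_sum _ _ _) _; apply: le_trans (ler_sum _ (fun i _ => hf i)) _.
by rewrite sumr_const card_ord mulr_natr.
Qed.

Lemma box_freq01 (R : realType) (d N : nat) (x : 'I_N -> 'rV[R]_d) y :
  0 <= box_freq x y <= 1.
Proof.
have h n : 0 <= (\1_(anchored_box y) (x n) : R) <= 1.
  by rewrite indicE; case: (_ \in _); rewrite /= ?lexx ler01.
rewrite /box_freq mean_ge0 /=; last by move=> n; case/andP: (h n).
rewrite (le_trans (ler_norm _)) // mean_norm_le // => n.
by case/andP: (h n) => h0 h1; rewrite ger0_norm.
Qed.

Lemma le_star_discrepancy (R : realType) (d N : nat) (x : 'I_N -> 'rV[R]_d) y :
  closed_cube y -> `|box_freq x y - box_vol y| <= star_discrepancy x.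
Proof.
move=> hy; apply: ub_le_sup; last by exists y.
exists 1 => _ [z hz <-].
have := box_freq01 x z; have := box_vol01 hz; rewrite -/(box_freq x z).
move: (box_freq x z) (box_vol z) => a b /andP[b0 b1] /andP[a0 a1].
by rewrite ler_norml; apply/andP; split; lra.
Qed.

Lemma closed_cube0 (R : realType) (d : nat) : closed_cube (0 : 'rV[R]_d).
Proof. by move=> j; rewrite mxE lexx ler01. Qed.

Lemma star_discrepancy_le (R : realType) (d N : nat) (x : 'I_N -> 'rV[R]_d) (e : R) :
  (forall y, closed_cube y -> `|box_freq x y - box_vol y| <= e) ->
  star_discrepancy x <= e.
Proof.
move=> h; apply: ge_sup => [|_ [y hy <-]]; last exact: h.
by exists `|box_freq x 0 - box_vol (0 : 'rV[R]_d)|; exists 0; first exact: closed_cube0.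
Qed.

Lemma star_discrepancy_ge0 (R : realType) (d N : nat) (x : 'I_N -> 'rV[R]_d) :
  0 <= star_discrepancy x.
Proof. exact: le_trans (le_star_discrepancy x (@closed_cube0 R d)). Qed.

Lemma min_star_discrepancy_le (R : realType) (d N : nat)
    (x : 'I_N -> 'rV[R]_d) (e : R) :
  (forall n, halfopen_cube (x n)) -> star_discrepancy x <= e ->
  min_star_discrepancy R N d <= e.
Proof.
move=> hx; apply: le_trans; apply: ge_inf; last by exists x.
by exists 0 => _ [z _ <-]; apply: star_discrepancy_ge0.
Qed.

(** An infimum need not be attained, so the slack between [e1] and [e2] is what buys an actual point
    set. *)
Lemma near_optimal_points (R : realType) (d N : nat) (e1 e2 : R) :
  min_star_discrepancy R N d <= e1 -> e1 < e2 ->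
  exists x : 'I_N -> 'rV[R]_d,
    (forall n, halfopen_cube (x n)) /\ star_discrepancy x < e2.
Proof.
move=> h12 /(le_lt_trans h12) h.
have [|_ [x hx <-] hlt] := inf_lt _ h; last by exists x.
exists (star_discrepancy (fun _ : 'I_N => 0 : 'rV[R]_d)).
by exists (fun=> 0) => // n j; rewrite mxE lexx ltr01.
Qed.

Lemma inverse_star_discrepancy_le (R : realType) (d N : nat) (eps : R) :
  (0 < N)%N -> min_star_discrepancy R N d <= eps ->
  (inverse_star_discrepancy d eps <= N%:R%:E)%E.
Proof.
move=> N0 hN; rewrite /inverse_star_discrepancy /nat_min.
case: pselect => [exA|]; last by case; exists N; apply/asboolP.
case: ex_minnP => m _ /(_ N) hm; rewrite lee_fin ler_nat hm //.
exact/asboolP.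
Qed.

Lemma inverse_star_discrepancy_leP (R : realType) (d : nat) (eps c : R) :
  (inverse_star_discrepancy d eps <= c%:E)%E ->
  exists N, [/\ (0 < N)%N, min_star_discrepancy R N d <= eps & N%:R <= c].
Proof.
rewrite /inverse_star_discrepancy /nat_min; case: pselect => // exA.
by case: ex_minnP => m /asboolP[m0 hm] _; rewrite lee_fin => hc; exists m.
Qed.

(** * Parities and the accuracy exponent *)

(** The Gram matrices [V V^T] and [V^T V] have the same Frobenius norm; both sums of squares expand
    into the same fourfold sum. *)
Lemma sum_sqr_inner_products (R : comPzRingType) (I A : finType) (v : I -> A -> R) :
  \sum_n \sum_m (\sum_a v n a * v m a) ^+ 2 =
  \sum_a \sum_b (\sum_n v n a * v n b) ^+ 2.
Proof.
have l : \sum_n \sum_m (\sum_a v n a * v m a) ^+ 2 =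
    \sum_n \sum_m \sum_a \sum_b (v n a * v m a) * (v n b * v m b).
  by apply: eq_bigr => n _; apply: eq_bigr => m _; rewrite expr2 big_distrlr.
rewrite l; under eq_bigr do rewrite exchange_big /=.
rewrite exchange_big /=; apply: eq_bigr => a _.
under eq_bigr do rewrite exchange_big /=.
rewrite exchange_big /=; apply: eq_bigr => b _.
rewrite expr2 big_distrlr /=; apply: eq_bigr => n _.
by apply: eq_bigr => m _; ring.
Qed.

(** A Welch-type bound. The diagonal alone makes the sum over pairs of points at least [n M^2]; the
    sum over pairs in [A] is at most [M n^2 + M^2 n^2 b^2]. So [M <= n + n b^2 M], and [2 n <= M]
    absorbs the first term. *)
Lemma sign_vectors_correlation (R : realFieldType) (N : nat) (A : finType)
    (v : 'I_N -> A -> R) (b : R) :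
  (forall n a, v n a ^+ 2 = 1) -> (0 < N)%N -> (2 * N <= #|A|)%N ->
  (forall a c, a != c -> `|N%:R^-1 * \sum_n v n a * v n c| <= b) ->
  (2 * N%:R)^-1 <= b ^+ 2.
Proof.
move=> v1 N0 hNA hb.
set M : R := #|A|%:R; set n : R := N%:R.
have n0 : 0 < n by rewrite ltr0n.
have hM : 2 * n <= M by rewrite -natrM ler_nat.
have M0 : 0 < M by lra.
have diag k : \sum_a v k a * v k a = M.
  by under eq_bigr do rewrite -expr2 v1; rewrite sumr_const.
have lo : n * M ^+ 2 <= \sum_n \sum_m (\sum_a v n a * v m a) ^+ 2.
  have -> : n * M ^+ 2 = \sum_(k < N) M ^+ 2 by rewrite sumr_const card_ord mulr_natl.
  apply: ler_sum => k _; rewrite (bigD1 k) //= diag lerDl sumr_ge0 // => *.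
  exact: sqr_ge0.
have hi : \sum_a \sum_c (\sum_n v n a * v n c) ^+ 2 <=
    M * (n ^+ 2 + M * (n ^+ 2 * b ^+ 2)).
  rewrite [leRHS]mulr_natl -sumr_const; apply: ler_sum => a _.
  rewrite (bigD1 a) //=; apply: lerD.
    under eq_bigr do rewrite -expr2 v1.
    by rewrite sumr_const card_ord.
  apply: (@le_trans _ _ (\sum_(c | c != a) n ^+ 2 * b ^+ 2)).
    apply: ler_sum => c ca.
    have -> : \sum_n v n a * v n c = n * (n^-1 * \sum_n v n a * v n c).
      by rewrite mulrA divff ?mul1r // gt_eqF.
    rewrite exprMn ler_wpM2l ?sqr_ge0 // -[X in X <= _]real_normK ?num_real //.
    rewrite lerXn2r ?nnegrE ?normr_ge0 //; last by apply: hb; rewrite eq_sym.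
    by apply: le_trans (hb a c _); rewrite // eq_sym.
  rewrite sumr_const [leRHS]mulr_natl ler_wpMn2l //.
    by rewrite mulr_ge0 ?sqr_ge0.
  exact: max_card.
move: lo; rewrite sum_sqr_inner_products => /le_trans /(_ hi) h.
have {}h : M * (n * M) <= M * (n * (n + n * b ^+ 2 * M)) by move: h; rewrite !expr2; lra.
rewrite ler_pM2l // ler_pM2l // in h.
have {}h : M * 2^-1 <= M * (n * b ^+ 2) by lra.
rewrite ler_pM2l // in h.
by rewrite invfM ler_pdivrMr // mulrC.
Qed.

Definition rademacher (R : realType) (d : nat) (x : 'rV[R]_d) (j : 'I_d) : R :=
  2 * (x 0 j < 2^-1)%R%:R - 1.

(* Carrying the indicators [T] along makes the expansion
   [rademacher x j = 2 * (x_j < 1/2) - 1] an induction on [S]. *)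
Lemma parity_mean (R : realType) (d N : nat) (x : 'I_N -> 'rV[R]_d)
    (S T : seq 'I_d) :
  (forall n, halfopen_cube (x n)) -> uniq (S ++ T) ->
  `|N%:R^-1 * \sum_n ((\prod_(j <- T) (x n 0 j < 2^-1)%R%:R) *
                      \prod_(j <- S) rademacher (x n) j)
    - 2^-1 ^+ size T * (nilp S)%:R| <= 3 ^+ size S * star_discrepancy x.
Proof.
move=> hx; elim: S T => [|j S IH] T /= uST.
  pose y : 'rV[R]_d := \row_j if j \in T then 2^-1 else 1.
  have hy : closed_cube y.
    move=> i; rewrite mxE; case: ifP => _; rewrite ?ler01 ?lexx //.
    by rewrite invr_ge0 invf_le1 ?ler1n ?ltr0n ?ler0n.
  have := le_star_discrepancy x hy; rewrite mul1r mulr1.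
  have -> : box_freq x y = N%:R^-1 * (\sum_n (\prod_(j <- T)
      (x n 0 j < 2^-1)%R%:R * \prod_(j <- [::]) rademacher (x n) j)).
    congr (_ * _); apply: eq_bigr => n _; rewrite big_nil mulr1 indic_box //.
    rewrite [RHS]big_uniq // [RHS]big_mkcond /=; apply: eq_bigr => i _.
    by rewrite mxE; case: ifP => // _; case/andP: (hx n i) => _ ->.
  suff -> : box_vol y = 2^-1 ^+ size T by [].
  rewrite /box_vol; under eq_bigr do rewrite mxE.
  by rewrite -big_mkcond -big_uniq //= big_const_seq count_predT -Monoid.iteropE.
have u1 : uniq (S ++ T) by case/andP: uST.
have u2 : uniq (S ++ j :: T).
  by rewrite (uniq_catCA S [:: j] T).
(* The main terms cancel, since [2 * 2^-(|T|+1) = 2^-|T|], and the errors add up with weights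
   [1 + 2 = 3]. *)
have h1 := IH _ u1; have h2 := IH _ u2.
set D := star_discrepancy x in h1 h2 *.
move: h1 h2; rewrite /= exprS.
under [in X in _ -> X -> _]eq_bigr do rewrite big_cons.
set s1 := \sum_n _; set s2 := \sum_n _.
move=> h1 h2.
have -> : \sum_n (\prod_(j0 <- T) (x n 0 j0 < 2^-1)%R%:R *
     \prod_(j0 <- j :: S) rademacher (x n) j0) = 2 * s2 - s1.
  rewrite /s1 /s2 mulr_sumr -sumrB; apply: eq_bigr => n _.
  by rewrite big_cons /rademacher; ring.
rewrite mulr0 subr0 exprS.
move: h1 h2; move: (nilp S)%:R => e.
rewrite mulrBr mulrCA -(mulrA 3).
move: (_ * s1) (_ * s2) (2^-1 ^+ size T) (3 ^+ size S * D) => a c t B.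
by rewrite !ler_norml => /andP[? ?] /andP[? ?]; apply/andP; split; lra.
Qed.

Lemma rademacher_sqr (R : realType) (d : nat) (x : 'rV[R]_d) j :
  rademacher x j ^+ 2 = 1.
Proof. by rewrite /rademacher; case: (_ < _); rewrite /=; ring. Qed.

Lemma star_discrepancy_parity_lb (R : realType) (d N k : nat)
    (x : 'I_N -> 'rV[R]_d) :
  (forall n, halfopen_cube (x n)) -> (0 < N)%N -> (2 * N <= 'C(d, k))%N ->
  (2 * N%:R)^-1 <= (9 ^+ k * star_discrepancy x) ^+ 2.
Proof.
move=> hx N0 hN.
pose A := {S : {set 'I_d} | #|S| == k}.
have cA : #|{: A}| = 'C(d, k).
  have := card_draws 'I_d k; rewrite card_ord => <-.
  by rewrite card_sig; apply: eq_card => S; rewrite !inE.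
apply: (@sign_vectors_correlation _ N A (fun n S => \prod_(j in val S) rademacher (x n) j)).
- by move=> n a; rewrite -prodrXl big1 // => j _; apply: rademacher_sqr.
- by [].
- by rewrite cA.
move=> S T ST.
(* On coordinates common to [S] and [T] the Rademacher signs square to 1, so the product of the two
   parities is the parity on the symmetric difference. *)
pose U := [set j | (j \in val S) (+) (j \in val T)].
have U0 : enum U != [::].
  apply: contraNN ST => /eqP e; apply/eqP/val_inj/setP => j.
  have : j \notin enum U by rewrite e.
  by rewrite mem_enum inE; case: (j \in _); case: (j \in _).
have cU : (size (enum U) <= 2 * k)%N.
  have := leq_card_setU (val S) (val T).
  rewrite (eqP (valP S)) (eqP (valP T)) addnn -mul2n -cardE; apply: leq_trans.
  apply/subset_leq_card/fintype.subsetP => j; rewrite !inE; by case: (j \in _).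
have := @parity_mean _ _ _ x (enum U) [::] hx.
rewrite cats0 enum_uniq => /(_ isT).
rewrite /nilp size_eq0 (negbTE U0) mulr0 subr0 => h.
apply: le_trans (le_trans h _); last first.
  rewrite ler_wpM2r ?star_discrepancy_ge0 // (_ : 9 = 3 ^+ 2); last by ring.
  by rewrite -exprM ler_weXn2l // ler1n.
rewrite le_eqVlt; apply/orP; left; apply/eqP; congr (`|_ * _|).
apply: eq_bigr => n _; rewrite big_nil mul1r big_enum /=.
rewrite [X in X * _]big_mkcond [X in _ * X]big_mkcond -big_split [RHS]big_mkcond /=.
apply: eq_bigr => j _; rewrite inE.
by case: (j \in _); case: (j \in _); rewrite /= ?mulr1 ?mul1r // -expr2 rademacher_sqr.
Qed.

(** * Traces of boxes and the dimension exponent *)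

Lemma sum_subsets_exp2 (d : nat) :
  (\sum_(S : {set 'I_d}) 2 ^ (d - #|S|) = 3 ^ d)%N.
Proof.
rewrite -[X in (3 ^ X)%N]card_ord -prod_nat_const.
have -> := @bigA_distr nat 0%N 1%N muln addn 'I_d (fun=> 1%N) (fun=> 2%N).
apply: eq_big => // S _.
rewrite (eq_bigr (fun i => if i \in ~: S then 2 else 1)%N); last first.
  by move=> i _; rewrite inE; case: (i \in S).
rewrite -big_mkcond prod_nat_const; congr (2 ^ _)%N.
by have := cardsC S; rewrite card_ord; lia.
Qed.

(** In the expansion of [(1 + 2)^(5e)] over subsets, every set of the ball has weight at least
    [2^(4e)]. *)
Lemma hamming_ball_card (e : nat) :
  (#|[set S : {set 'I_(5 * e)} | (#|S| <= e)%N]| <= 2 ^ (4 * e))%N.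
Proof.
have h : (#|[set S : {set 'I_(5 * e)} | (#|S| <= e)%N]| * 2 ^ (4 * e) <= 3 ^ (5 * e))%N.
  rewrite -sum_subsets_exp2 -sum_nat_const [leqRHS](bigID (fun S => S \in
    [set S : {set 'I_(5 * e)} | (#|S| <= e)%N])) /=.
  apply: leq_trans (leq_addr _ _); apply: leq_sum => S; rewrite inE => hS.
  by rewrite leq_exp2l //; lia.
rewrite -(@leq_pmul2r (2 ^ (4 * e))) ?expn_gt0 //; apply: leq_trans h _.
rewrite -expnD -mulnDl !expnM.
(* [3 ^ 5 = 243 <= 256 = 2 ^ 8] *)
by have [->|e0] := posnP e; first by []; rewrite leq_exp2r.
Qed.

Definition symdiff (I : finType) (S T : {set I}) : {set I} :=
  [set j | (j \in S) (+) (j \in T)].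

(** Symmetric difference with a fixed member of a fiber maps that fiber injectively into the ball
    around the empty set. *)
Lemma card_fibers_symdiff (I B : finType) (e : nat) (f : {set I} -> B) :
  (forall S T, f S = f T -> #|symdiff S T| <= e)%N ->
  (2 ^ #|I| <= #|B| * #|[set S : {set I} | (#|S| <= e)%N]|)%N.
Proof.
move=> hf; set ball := [set S : {set I} | _].
have -> : (2 ^ #|I| = #|{: {set I}}|)%N.
  by rewrite -cardsT -card_powerset powersetT cardsT.
rewrite -[leqLHS]sum1_card (partition_big f xpredT) //= -[leqRHS]sum_nat_const.
apply: leq_sum => b _; rewrite sum1_card.
set F := [pred S | f S == b].
have [S0 /eqP S0b|F0] := pickP F; last by rewrite (eq_card0 F0).
have inj : {in F &, injective (symdiff S0)}.
  move=> S T _ _ /setP h; apply/setP => j; have := h j; rewrite !inE.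
  by case: (j \in S0); case: (j \in S); case: (j \in T).
rewrite -(card_in_imset inj); apply/subset_leq_card/fintype.subsetP => _ /imsetP[S Sb ->].
by rewrite inE hf // S0b (eqP Sb).
Qed.

Lemma bernoulli_ineq (R : realFieldType) (t : R) (n : nat) :
  0 <= t <= 1 -> 1 - n%:R * t <= (1 - t) ^+ n.
Proof.
case/andP => t0 t1; elim: n => [|n IH]; first by rewrite mul0r subr0 expr0.
rewrite exprS -natr1.
have h : 0 <= n%:R * (t * t) by rewrite !mulr_ge0.
have /= := ler_wpM2l (_ : 0 <= 1 - t) IH; rewrite subr_ge0 => /(_ t1); lra.
Qed.

Lemma exp_gap (R : realFieldType) (b : R) (s m d : nat) :
  0 <= b <= 1 -> (s + m <= d)%N ->
  m%:R * (b ^+ d * (1 - b)) <= b ^+ s - b ^+ (s + m).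
Proof.
case/andP => b0 b1; elim: m => [|m IH] hd; first by rewrite addn0 mul0r subrr.
have {IH} := IH ltac:(lia); rewrite addnS exprS -natr1.
have : b ^+ d * (1 - b) <= b ^+ (s + m) * (1 - b).
  by rewrite ler_wpM2r ?subr_ge0 // ler_wiXn2l //; lia.
lra.
Qed.

(** The shrinkage [1/(2d)] is the right scale: by Bernoulli's inequality the box keeps at least half
    of its volume even if all [d] sides are shortened. *)
Definition slab_corner (R : realType) (d : nat) (S : {set 'I_d}) : 'rV[R]_d :=
  \row_j if j \in S then 1 - (2 * d%:R)^-1 else 1.

Section SlabCorner.
Variables (R : realType) (d : nat).
Hypothesis d0 : (0 < d)%N.
Let b : R := 1 - (2 * d%:R)^-1.

Let t01 : 0 <= ((2 * d%:R)^-1 : R) <= 1.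
Proof.
have d1 : (1 : R) <= d%:R by rewrite ler1n.
by rewrite invr_ge0 invf_le1; lra.
Qed.

Lemma slab_corner_cube (S : {set 'I_d}) : closed_cube (slab_corner R S).
Proof.
move=> j; rewrite mxE; case: ifP => _; last by rewrite ler01 lexx.
by case/andP: t01 => *; apply/andP; split; lra.
Qed.

Lemma slab_corner_vol (S : {set 'I_d}) : box_vol (slab_corner R S) = b ^+ #|S|.
Proof.
rewrite /box_vol; under eq_bigr do rewrite mxE.
by rewrite -big_mkcond prodr_const.
Qed.

(** Each side shortened in passing from [S] to [S :|: T] costs at least [1/2 * 1/(2d)] of volume. *)
Lemma slab_corner_gap (S T : {set 'I_d}) :
  #|T :\: S|%:R <= 4 * d%:R * (box_vol (slab_corner R S)
                               - box_vol (slab_corner R (S :|: T))).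
Proof.
have d1 : (1 : R) <= d%:R by rewrite ler1n.
have cST : #|S :|: T| = (#|S| + #|T :\: S|)%N.
  rewrite -(cardsID S (S :|: T)); congr (_ + _)%N; apply: eq_card => j;
    by rewrite !inE; case: (j \in S); case: (j \in T).
have hd : (#|S| + #|T :\: S| <= d)%N by rewrite -cST -[leqRHS]card_ord max_card.
have b01 : 0 <= b <= 1 by case/andP: t01 => *; apply/andP; split; rewrite /b; lra.
have bd : 2^-1 <= b ^+ d.
  apply: le_trans (bernoulli_ineq d t01); rewrite invfM mulrCA divff ?mulr1; lra.
have := exp_gap b01 hd; rewrite !slab_corner_vol cST.
move: (#|_ :\: _|%:R) (b ^+ #|S| - _) (ler0n R #|T :\: S|) => m g m0 hg.
have hm : m * (2^-1 * (2 * d%:R)^-1) <= g.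
  have -> : (2 * d%:R)^-1 = 1 - b by rewrite subKr.
  apply: le_trans hg; rewrite ler_wpM2l // ler_wpM2r // subr_ge0.
  by case/andP: b01.
have -> : m = 4 * d%:R * (m * (2^-1 * (2 * d%:R)^-1)) by field; lra.
by rewrite ler_wpM2l //; lra.
Qed.

(** The box of [S :|: T] is the intersection of the other two, so it holds the same points as that
    of [S]. The volume gap is then at most twice the discrepancy. *)
Lemma star_discrepancy_trace (N : nat) (x : 'I_N -> 'rV[R]_d) (S T : {set 'I_d}) :
  (forall n, halfopen_cube (x n)) ->
  (forall n, [forall j, x n 0 j < slab_corner R S 0 j] =
             [forall j, x n 0 j < slab_corner R T 0 j]) ->
  #|T :\: S|%:R <= 8 * d%:R * star_discrepancy x.
Proof.
move=> hx hST; apply: le_trans (slab_corner_gap S T) _.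
have e : box_freq x (slab_corner R S) = box_freq x (slab_corner R (S :|: T)).
  congr (_ * _); apply: eq_bigr => n _; rewrite !indic_box // !prod_bool.
  congr (nat_of_bool _)%:R; apply/forallP/forallP => h j; last first.
    by have := h j; rewrite !mxE inE; case: (j \in S) => //=; case: ifP => // _ _;
       case/andP: (hx n j).
  have hT : [forall j, x n 0 j < slab_corner R T 0 j] by rewrite -hST; apply/forallP.
  have := h j; have := forallP hT j; rewrite !mxE inE.
  by case: (j \in S).
have h1 := le_star_discrepancy x (slab_corner_cube S).
have := le_star_discrepancy x (slab_corner_cube (S :|: T)); rewrite -e.
move: h1; rewrite !ler_norml => /andP[? ?] /andP[? ?].
have -> : 8 * d%:R * star_discrepancy x = 4 * d%:R * (2 * star_discrepancy x) by ring.
by rewrite ler_wpM2l //; lra.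
Qed.

End SlabCorner.

(** With [d = 5e] and discrepancy at most [1/80], equal traces force [#|T :\: S| <= e/2] both ways,
    so fibers lie in balls of radius [e]. Counting gives [2^(5e) <= 2^N * 2^(4e)]. *)
Lemma small_discrepancy_card (R : realType) (e N : nat)
    (x : 'I_N -> 'rV[R]_(5 * e)) :
  (forall n, halfopen_cube (x n)) -> star_discrepancy x <= 80^-1 -> (e <= N)%N.
Proof.
move=> hx hD; case: (posnP e) => [->//|e0].
have d0 : (0 < 5 * e)%N by lia.
pose f (S : {set 'I_(5 * e)}) : {ffun 'I_N -> bool} :=
  [ffun n => [forall j, x n 0 j < slab_corner R S 0 j]].
have hf S T : f S = f T -> (#|symdiff S T| <= e)%N.
  move=> fST.
  have tr n : [forall j, x n 0 j < slab_corner R S 0 j] =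
      [forall j, x n 0 j < slab_corner R T 0 j].
    by have /ffunP/(_ n) := fST; rewrite !ffunE.
  have h1 := star_discrepancy_trace d0 hx tr.
  have h2 := star_discrepancy_trace d0 hx (fun n => esym (tr n)).
  have sub : symdiff S T \subset (S :\: T) :|: (T :\: S).
    by apply/fintype.subsetP => j; rewrite !inE; case: (j \in S); case: (j \in T).
  have := leq_trans (subset_leq_card sub) (leq_card_setU _ _).
  rewrite -(ler_nat R) natrD => /le_trans hc; rewrite -(ler_nat R); apply: hc.
  have : 8 * (5 * e)%:R * star_discrepancy x <= 8 * (5 * e)%:R * 80^-1.
    by rewrite ler_wpM2l // mulr_ge0.
  by rewrite natrM; lra.
have := card_fibers_symdiff hf; rewrite card_ffun card_bool !card_ord => h.
have := leq_trans h (leq_mul (leqnn _) (hamming_ball_card e)).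
by rewrite -expnD leq_exp2l //; lia.
Qed.

(** * Lower bounds for the exponents *)

Lemma powR_growth (R : realType) (a b c B : R) (n0 : nat) :
  0 < c -> (forall n, (n0 <= n)%N -> c * n%:R `^ a <= B * n%:R `^ b) -> a <= b.
Proof.
move=> c0 h; rewrite leNgt; apply/negP => ba.
have t0 : 0 < a - b by rewrite subr_gt0.
(* Chosen so that [X^(a-b) = |B|/c + 1]; any [n > X] then violates the inequality. *)
pose X := (`|B| / c + 1) `^ (a - b)^-1.
pose n := (maxn n0 (Num.truncn X).+1).
have Xn : X < n%:R.
  apply: lt_le_trans (truncnS_gt _) _; last by rewrite ler_nat leq_maxr.
have X0 : 0 <= X by apply: powR_ge0.
have n0' : 0 < n%:R :> R by apply: le_lt_trans Xn.
have := h n (leq_maxl _ _).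
have -> : a = b + (a - b) by ring.
rewrite powRD; last by rewrite (gt_eqF n0') implybT.
rewrite mulrCA mulrC ler_pM2r ?powR_gt0 // => h1.
have h2 : `|B| / c + 1 < n%:R `^ (a - b).
  have -> : `|B| / c + 1 = X `^ (a - b).
    rewrite /X -powRrM mulVf ?gt_eqF // powRr1 //.
    by rewrite addr_ge0 // divr_ge0 // ltW.
  by rewrite gt0_ltr_powR // nnegrE ltW.
have : c * (`|B| / c + 1) < B by apply: lt_le_trans h1; rewrite ltr_pM2l.
rewrite mulrDr mulr1 mulrCA divff ?gt_eqF // mulr1 ltNge; case/negP.
by rewrite (le_trans (ler_norm _)) // lerDl ltW.
Qed.

Lemma inverse_bound_ge1 (R : realType) (C p q eps1 : R) :
  0 < C -> 0 < eps1 -> inverse_bound C p q eps1 -> 1 <= q.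
Proof.
move=> C0 e10 hb.
(* The accuracy stays fixed while [d = 5e] grows; [1/160] leaves room below the threshold [1/80]. *)
pose eps : R := Num.min 160^-1 eps1.
have eps0 : 0 < eps by rewrite lt_min e10 invr_gt0 ltr0n.
apply: (@powR_growth R 1 q 1 (C * 5 `^ q * eps `^ (- p)) 1) => // e e0.
have d0 : (0 < 5 * e)%N by rewrite muln_gt0.
have eh : 0 < eps <= eps1 by rewrite eps0 ge_min lexx orbT.
have [N [N0 hN hNC]] := inverse_star_discrepancy_leP (hb (5 * e)%N eps d0 eh).
have e80 : eps < 80^-1.
  by rewrite gt_min; apply/orP; left; rewrite ltf_pV2 ?posrE ?ltr0n // ltr_nat.
have [x [hx hD]] := near_optimal_points hN e80.
have eN := small_discrepancy_card hx (ltW hD).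
rewrite mul1r powRr1 //.
have -> : C * 5 `^ q * eps `^ (- p) * e%:R `^ q = C * (5 * e)%:R `^ q * eps `^ (- p).
  by rewrite natrM powRM //; ring.
by apply: le_trans hNC; rewrite ler_nat.
Qed.

Lemma leq_ffact_exp (n k : nat) : ((n - k) ^ k <= n ^_ k <= n ^ k)%N.
Proof.
elim: k => [//|k /andP[IH1 IH2]]; rewrite ffactnSr !expnSr.
apply/andP; split; last by rewrite leq_mul // leq_subr.
rewrite leq_mul ?leq_sub2l //; apply: leq_trans IH1.
by case: k {IH2} => // k; rewrite leq_exp2r // leq_sub2l.
Qed.

Lemma leq_bin_exp (n k : nat) : ('C(n, k) <= n ^ k)%N.
Proof.
have /andP[_ h] := leq_ffact_exp n k; apply: leq_trans h.
by rewrite -bin_ffact leq_pmulr // fact_gt0.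
Qed.

Lemma exp_leq_bin (n k : nat) :
  (2 * k <= n)%N -> (n ^ k <= 2 ^ k * (k`! * 'C(n, k)))%N.
Proof.
move=> kn; have /andP[h _] := leq_ffact_exp n k.
rewrite (mulnC k`!) bin_ffact; apply: leq_trans (leq_mul (leqnn _) h).
by rewrite -expnMn; case: k kn {h} => // k kn; rewrite leq_exp2r //; lia.
Qed.

(** Parities of degree [2k] force [N] to be of order [d^(2k)] at accuracy of order [d^(-k)], where
    the assumed bound is of order [d^(q + kp)]. *)
Lemma inverse_bound_exponents (R : realType) (C p q eps1 : R) (k : nat) :
  (0 < k)%N -> 0 < eps1 -> inverse_bound C p q eps1 ->
  (2 * k)%:R <= q + k%:R * p.
Proof.
move=> k0 e10 hb.
(* This constant gives [9^(2k) * (2 eps) = d^(-k)] for the [eps] below, the threshold at which the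
   parity bound is contradicted. *)
pose c : R := 2 * 81 ^+ k.
have c1 : 1 <= c.
  have : 1 <= 81 ^+ k :> R by rewrite exprn_ege1 // ler1n.
  by rewrite /c; lra.
have c0 : 0 < c by apply: lt_le_trans c1.
pose B : R := (2 * (2 ^ (2 * k) * (2 * k)`!))%:R * C * c `^ p.
apply: (@powR_growth R _ _ 1 B (maxn (4 * k) (Num.truncn eps1^-1).+1)) => // d.
rewrite geq_max => /andP[kd ed].
have d0 : (0 < d)%N by lia.
have d0' : 0 < d%:R :> R by rewrite ltr0n.
have d1 : 1 <= d%:R ^+ k :> R by rewrite exprn_ege1 // ler1n.
pose eps : R := (c * d%:R ^+ k)^-1.
have cd0 : 0 < c * d%:R ^+ k by rewrite mulr_gt0 // exprn_gt0.
have eps0 : 0 < eps by rewrite invr_gt0.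
have eh : 0 < eps <= eps1.
  rewrite eps0 /= -[eps1]invrK lef_pV2 ?posrE ?invr_gt0 //.
  apply: (@le_trans _ _ d%:R).
    by apply: ltW; apply: lt_le_trans (truncnS_gt _) _; rewrite ler_nat.
  apply: (@le_trans _ _ (d%:R ^+ k)); last by rewrite ler_peMl // exprn_ge0.
  by rewrite ler_eXnr // ler1n.
have [N [N0 hN hNC]] := inverse_star_discrepancy_leP (hb d eps d0 eh).
have e2 : eps < 2 * eps by lra.
have [x [hx hD]] := near_optimal_points hN e2.
have NC : ('C(d, 2 * k) < 2 * N)%N.
  rewrite ltnNge; apply/negP => h.
  have := star_discrepancy_parity_lb hx N0 h; apply/negP; rewrite -ltNge.
  have l1 : (d%:R ^+ k) ^- 2 <= (2 * N%:R)^-1 :> R.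
    rewrite lef_pV2 ?posrE ?exprn_gt0 ?mulr_gt0 ?ltr0n // -exprM mulnC -natrM -natrX ler_nat.
    exact: leq_trans h (leq_bin_exp _ _).
  apply: lt_le_trans l1; rewrite -exprVn ltrXn2r ?nnegrE ?invr_ge0 ?exprn_ge0 //.
    by rewrite mulr_ge0 ?exprn_ge0 ?star_discrepancy_ge0.
  have -> : (d%:R ^+ k)^-1 = 9 ^+ (2 * k) * (2 * eps) :> R.
    have -> : 9 ^+ (2 * k) = 81 ^+ k :> R by rewrite exprM; congr (_ ^+ _); ring.
    by rewrite /eps /c; field; rewrite !gt_eqF ?exprn_gt0 ?ltr0n.
  by rewrite ltr_pM2l // exprn_gt0.
have dk : (2 * (2 * k) <= d)%N by lia.
have h1 : (d ^ (2 * k) <= 2 * (2 ^ (2 * k) * (2 * k)`!) * N)%N.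
  apply: leq_trans (exp_leq_bin dk) _.
  by rewrite mulnA [leqLHS]mulnC [leqRHS]mulnAC leq_mul // ltnW.
rewrite mul1r powR_mulrn // -natrX.
have h2 : (d ^ (2 * k))%:R <= (2 * (2 ^ (2 * k) * (2 * k)`!))%:R * N%:R :> R.
  by rewrite -natrM ler_nat.
apply: (le_trans h2).
have -> : B * d%:R `^ (q + k%:R * p) =
   (2 * (2 ^ (2 * k) * (2 * k)`!))%:R * (C * d%:R `^ q * eps `^ (- p)).
  rewrite /B powRD; last by rewrite (gt_eqF d0') implybT.
  rewrite powRN /eps -[(c * _) ^-1]powR_inv1 ?ltW // -powRrM mulN1r powRN invrK.
  rewrite powRM ?ltW ?exprn_gt0 // -powR_mulrn // -powRrM; ring.
by rewrite ler_wpM2l.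
Qed.

(** The previous inequality reads [k (2 - p) <= q], which fails for [k > q / (2 - p)] if [p < 2]. *)
Lemma inverse_bound_ge2 (R : realType) (C p q eps1 : R) :
  0 < eps1 -> inverse_bound C p q eps1 -> 2 <= p.
Proof.
move=> e10 hb; rewrite leNgt; apply/negP => p2.
have t0 : 0 < 2 - p by lra.
have := inverse_bound_exponents (ltn0Sn (Num.truncn (q / (2 - p)))) e10 hb.
have := truncnS_gt (q / (2 - p)); rewrite ltr_pdivrMr //.
by rewrite natrM; lra.
Qed.

(** * Bracketing covers *)

Lemma exists_expr_le (R : realType) (r e : R) :
  0 <= r < 1 -> 0 < e -> exists n, r ^+ n <= e.
Proof.
case/andP => r0 r1 e0.
have : `|r| < 1 by rewrite ger0_norm.
move=> /cvg_expr /cvgrPdist_lt /(_ _ e0) [n _ /(_ n (leqnn n))].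
by rewrite /= sub0r normrN ger0_norm ?exprn_ge0 // => /ltW; exists n.
Qed.

(* Weighting [k] by [z ^ (\sum_j k_j)] makes the count multiplicative. *)
Lemma card_bounded_sum (R : realFieldType) (d M : nat) (z : R) :
  0 <= z < 1 ->
  #|[pred k : {ffun 'I_d -> 'I_M.+1} | (\sum_j k j <= M)%N]|%:R * z ^+ M
    <= (1 - z)^-1 ^+ d.
Proof.
case/andP => z0 z1; set P := [pred k | _].
rewrite mulr_natl -sumr_const.
have le1 : \sum_(k in P) z ^+ M <= \sum_(k : {ffun 'I_d -> 'I_M.+1}) \prod_j z ^+ k j.
  rewrite [leRHS](bigID (fun k => k \in P)) /=; apply: ler_wpDr.
    by apply: sumr_ge0 => k _; apply: prodr_ge0 => j _; apply: exprn_ge0.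
  apply: ler_sum => k kP; rewrite prodrXr; apply: ler_wiXn2l => //; exact: ltW.
apply: le_trans le1 _.
rewrite -(bigA_distr_bigA (fun (_ : 'I_d) (i : 'I_M.+1) => z ^+ i)) /=.
rewrite prodr_const card_ord.
apply: lerXn2r; rewrite ?nnegrE ?sumr_ge0 ?invr_ge0 ?subr_ge0 ?(ltW z1) //.
  by move=> i _; apply: exprn_ge0.
rewrite -[leRHS]mul1r ler_pdivlMr ?subr_gt0 // mulrC.
have -> : (1 - z) * \sum_(i < M.+1) z ^+ i = 1 - z ^+ M.+1.
  by rewrite -[RHS]opprB subrX1 -mulNr opprB.
by rewrite gerBl exprn_ge0.
Qed.

Lemma bracketing_cover (R : realType) (d : nat) (delta : R) :
  (0 < d)%N -> 0 < delta <= 2^-1 ->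
  exists s : seq ('rV[R]_d * 'rV[R]_d),
  [/\ (size s)%:R <= (2 / delta ^+ 2) ^+ d,
      forall b, b \in s -> [/\ closed_cube b.1, closed_cube b.2
        & box_vol b.2 - box_vol b.1 <= delta] &
      forall y, closed_cube y ->
        exists2 b, b \in s & forall j, b.1 0 j <= y 0 j <= b.2 0 j].
Proof.
move=> d0 /andP[e0 e2].
pose r : R := (1 - delta) `^ d%:R^-1.
have r0 : 0 < r by rewrite powR_gt0; lra.
have rd : r ^+ d = 1 - delta.
  rewrite -powR_mulrn ?(ltW r0) // -powRrM mulVf ?powRr1 ?pnatr_eq0 -?lt0n //; lra.
have r1 : r < 1.
  rewrite ltNge; apply/negP => h.
  have : 1 <= r ^+ d by rewrite exprn_ege1.
  by rewrite rd; lra.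
have r01 : 0 <= r <= 1 by rewrite !ltW.
have rX n : 0 <= r ^+ n <= 1.
  by rewrite exprn_ge0 ?(ltW r0) //= exprn_ile1 ?(ltW r0) ?(ltW r1).
have exM : exists n, r ^+ n <= delta by apply: exists_expr_le => //; rewrite (ltW r0).
case: (ex_minnP exM) => M rM Mmin.
have M0 : (0 < M)%N by rewrite lt0n; apply/eqP => M0; move: rM; rewrite M0 expr0; lra.
have rhalf : 2^-1 <= r.
  apply: (@le_trans _ _ (r ^+ d)); first by rewrite rd; lra.
  by rewrite -[leRHS]expr1 ler_wiXn2l ?(ltW r0) ?(ltW r1).
have rM2 : delta / 2 <= r ^+ M.
  have h : delta < r ^+ M.-1.
    by rewrite ltNge; apply/negP => /Mmin; rewrite leqNgt ltn_predL M0.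
  rewrite -(prednK M0) exprS mulrC; apply: ler_pM => //; rewrite ?invr_ge0 //; exact: ltW.
(* Upper corners are [r ^ k_j] with [\sum_j k_j <= M]; as [r ^ d = 1 - delta],
   multiplying every side by [r] loses at most [delta] of the volume, while
   [\sum_j k_j = M] already means volume at most [delta]. *)
pose K := {ffun 'I_d -> 'I_M.+1}.
pose U (k : K) : 'rV[R]_d := \row_j r ^+ k j.
pose L (k : K) : 'rV[R]_d :=
  if (\sum_j k j < M)%N then \row_j r ^+ (k j).+1 else 0.
pose P := [pred k : K | (\sum_j k j <= M)%N].
have volU k : box_vol (U k) = r ^+ (\sum_j k j)%N.
  rewrite -prodrXr; by apply: eq_bigr => j _; rewrite mxE.
exists [seq (L k, U k) | k <- enum P]; split.
- rewrite size_map -cardE.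
  (* The weight [z = r^d = 1 - delta] makes the right side [delta^-d], while [z^M = (r^M)^d] is at
     least [(delta/2)^d]. *)
  have := @card_bounded_sum R d M (r ^+ d); rewrite exprn_ge0 ?(ltW r0) //=.
  rewrite {1}rd => /(_ ltac:(lra)); rewrite -exprM mulnC exprM rd subKr => h.
  have e20 : 0 < delta / 2 by lra.
  rewrite (_ : 2 / delta ^+ 2 = delta^-1 / (delta / 2)); last by field; lra.
  rewrite expr_div_n ler_pdivlMr ?exprn_gt0 //; apply: le_trans h.
  by rewrite ler_wpM2l // lerXn2r // nnegrE ?exprn_ge0 // ltW.
- move=> b /mapP[k]; rewrite mem_enum inE => hk -> /=; split.
  + rewrite /L; case: ifP => _; last exact: closed_cube0.
    by move=> j; rewrite mxE rX.
  + by move=> j; rewrite mxE rX.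
  rewrite volU /L; case: ltnP => hM.
    have -> : box_vol (\row_j r ^+ (k j).+1) = r ^+ (\sum_j k j)%N * r ^+ d.
      transitivity (\prod_(j < d) (r ^+ k j * r)).
        by apply: eq_bigr => j _; rewrite mxE exprSr.
      by rewrite big_split /= prodrXr prodr_const card_ord.
    rewrite rd mulrBr mulr1 subKr ler_piMl ?(ltW e0) //.
    by case/andP: (rX (\sum_j k j)%N).
  have -> : (\sum_j k j)%N = M by apply/eqP; rewrite eqn_leq hk hM.
  suff -> : box_vol (0 : 'rV[R]_d) = 0 by rewrite subr0.
  by rewrite /box_vol (bigD1 (Ordinal d0)) //= mxE mul0r.
move=> y hy.
pose Q := [pred k : K | (k \in P) && [forall j, y 0 j <= r ^+ k j]].
have Q0 : Q [ffun=> ord0].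
  rewrite /Q /= !inE big1 => [|j _]; last by rewrite ffunE.
  by apply/forallP => j; rewrite ffunE expr0; case/andP: (hy j).
(* For [k] with maximal sum no [k_j] can be increased, so [r ^ (k_j + 1) < y_j]. *)
case: (arg_maxnP (fun k : K => \sum_j k j)%N Q0) => k /andP[kP /forallP ky] kmax.
exists (L k, U k); first by apply/mapP; exists k => //; rewrite mem_enum.
move=> j; rewrite /= mxE ky andbT /L.
case: ltnP => hM; last by rewrite mxE; case/andP: (hy j).
rewrite mxE leNgt; apply/negP => yj.
have kjM : ((k j).+1 < M.+1)%N.
  by rewrite ltnS; apply: leq_ltn_trans hM; rewrite (bigD1 j) //= leq_addr.
pose k' : K := [ffun i => if i == j then Ordinal kjM else k i].
have sk' : (\sum_i k' i = (\sum_i k i).+1)%N.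
  rewrite (bigD1 j) //= [in RHS](bigD1 j) //= ffunE eqxx /= addSn; congr (_ + _).+1.
  by apply: eq_bigr => i /negbTE ij; rewrite ffunE ij.
have Qk' : Q k'.
  rewrite /Q /= inE sk' hM; apply/forallP => i; rewrite ffunE.
  by case: eqP => [->|_] //=; apply: ltW.
by have := kmax _ Qk'; rewrite sk' /geq /= ltnn.
Qed.

(** * Grid points *)

Lemma count_below (R : realType) (m : nat) (s : R) :
  0 <= s -> s <= m%:R ->
  s <= \sum_(i < m) (i%:R < s)%R%:R <= s + 1.
Proof.
move=> s0 sm.
pose S n : R := \sum_(i < n) (i%:R < s)%R%:R.
(* The hypothesis [s <= m] fails at early stages of the induction, so the cases [s <= m] and
   [m <= s] are carried together. *)
suff : [/\ S m <= m%:R, S m <= s + 1, s <= m%:R -> s <= S m & m%:R <= s -> m%:R <= S m].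
  by case=> _ h2 h3 _; rewrite h2 h3.
elim: m {sm} => [|m [h1 h2 h3 h4]].
  by rewrite /S big_ord0; split => //; lra.
rewrite /S big_ord_recr /= -natr1 -/(S m); case: ltP => ms /=.
  by split; have := h4 (ltW ms); lra.
by split; have := h3 ms; lra.
Qed.

Lemma prod_dist_le (R : realDomainType) (I : Type) (r : seq I) (a b : I -> R) :
  (forall i, 0 <= a i <= 1) -> (forall i, 0 <= b i <= 1) ->
  `|\prod_(i <- r) a i - \prod_(i <- r) b i| <= \sum_(i <- r) `|a i - b i|.
Proof.
move=> ha hb; elim: r => [|i r IH]; first by rewrite !big_nil subrr normr0.
rewrite !big_cons.
set A := \prod_(j <- r) a j; set B := \prod_(j <- r) b j.
have -> : a i * A - b i * B = (a i - b i) * A + b i * (A - B) by ring.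
have A01 : 0 <= A <= 1.
  rewrite /A prodr_ge0 => [|j _]; last by case/andP: (ha j).
  by rewrite prodr_ile1.
apply: le_trans (ler_normD _ _) _; rewrite !normrM; apply: lerD.
  by rewrite ler_piMr // ger0_norm; case/andP: A01.
apply: le_trans IH; rewrite ler_piMl // ger0_norm; by case/andP: (hb i).
Qed.

(** A finite sample space in place of Lebesgue measure: averages over random points become finite
    sums. *)
Definition grid_point (R : realType) (d m : nat) (g : {ffun 'I_d -> 'I_m}) :
  'rV[R]_d := \row_j ((g j)%:R / m%:R).

Lemma grid_point_cube (R : realType) (d m : nat) (g : {ffun 'I_d -> 'I_m}) :
  (0 < m)%N -> halfopen_cube (grid_point R g).
Proof.
move=> m0 j; rewrite mxE divr_ge0 //= ltr_pdivrMr ?ltr0n // mul1r ltr_nat.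
exact: ltn_ord.
Qed.

(** The frequency factors over the coordinates, and each factor is within [1/m] of the side. *)
Lemma grid_freq (R : realType) (d m : nat) (y : 'rV[R]_d) :
  (0 < m)%N -> closed_cube y ->
  `|#|{ffun 'I_d -> 'I_m}|%:R^-1 *
      (\sum_(g : {ffun 'I_d -> 'I_m}) \1_(anchored_box y) (grid_point R g))
    - box_vol y| <= d%:R / m%:R.
Proof.
move=> m0 hy.
have m0' : 0 < m%:R :> R by rewrite ltr0n.
pose a j : R := m%:R^-1 * \sum_(i < m) (i%:R < m%:R * y 0 j)%R%:R.
have hc j : m%:R * y 0 j <= \sum_(i < m) (i%:R < m%:R * y 0 j)%R%:R <= m%:R * y 0 j + 1.
  case/andP: (hy j) => y0 y1; apply: count_below; first by rewrite mulr_ge0.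
  by rewrite ler_piMr.
have -> : #|{ffun 'I_d -> 'I_m}|%:R^-1 *
    (\sum_(g : {ffun 'I_d -> 'I_m}) \1_(anchored_box y) (grid_point R g)) = \prod_j a j.
  rewrite big_split /= prodr_const bigA_distr_bigA /= card_ffun !card_ord natrX exprVn.
  congr (_ * _); apply: eq_bigr => g _; rewrite indic_box; last exact: grid_point_cube.
  apply: eq_bigr => j _; rewrite mxE ltr_pdivrMr //; by rewrite mulrC.
apply: le_trans (prod_dist_le _ _ _) _ => // [j|].
  rewrite mean_ge0 //=; apply: le_trans (ler_norm _) _.
  by apply: mean_norm_le => // i; case: (_ < _); rewrite /= ?normr1 ?normr0.
apply: (@le_trans _ _ (\sum_(j < d) m%:R^-1)); last first.
  by rewrite sumr_const card_ord mulr_natl.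
apply: ler_sum => j _; case/andP: (hc j) => h1 h2.
have -> : a j - y 0 j = m%:R^-1 * (\sum_(i < m) (i%:R < m%:R * y 0 j)%R%:R - m%:R * y 0 j).
  by rewrite mulrBr mulKf ?gt_eqF.
rewrite normrM ger0_norm ?invr_ge0 // ler_piMr ?invr_ge0 // ger0_norm; lra.
Qed.

(** * Random samples from a finite set *)

(** Squaring [1 - t/2 <= exp(-t/2)] gives [exp t <= (1 - t/2)^-2]; moreover [(1 + t + t^2)(1 -
    t/2)^2 - 1 = t^2 (1 - 3t + t^2)/4]. *)
Lemma expR_le_quadratic (R : realType) (t : R) :
  t <= 3^-1 -> expR t <= 1 + t + t ^+ 2.
Proof.
move=> t3; have h := expR_ge1Dx (- (t / 2)).
have h0 : 0 < 1 - t / 2 by lra.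
have {}h : (1 - t / 2) ^+ 2 <= expR (- t).
  have -> : expR (- t) = expR (- (t / 2)) ^+ 2 by rewrite -expRM_natl; congr expR; field.
  by rewrite lerXn2r ?nnegrE ?expR_ge0 // ltW.
have e0 := expR_gt0 t.
have : expR t * (1 - t / 2) ^+ 2 <= 1.
  by rewrite -[leRHS](mulfV (lt0r_neq0 e0)) -expRN ler_wpM2l // ltW.
rewrite -ler_pdivlMr ?exprn_gt0 // => /le_trans; apply.
rewrite ler_pdivrMr ?exprn_gt0 //.
have : 0 <= t ^+ 2 * ((1 - 3 * t) + t ^+ 2).
  by rewrite mulr_ge0 ?sqr_ge0 // addr_ge0 ?sqr_ge0 //; lra.
by rewrite !expr2; lra.
Qed.

Section Sampling.
Variables (R : realType) (G : finType).
Hypothesis G0 : (0 < #|G|)%N.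
Implicit Type f : G -> R.

Definition fmean f : R := #|G|%:R^-1 * \sum_g f g.

(** The linear term averages to zero and [f^2 <= f] bounds the variance by the mean. A Bernstein
    bound of this kind lets chain increments of small mean take a large [l]. *)
Lemma exp_moment f (l : R) :
  (forall g, 0 <= f g <= 1) -> `|l| <= 3^-1 ->
  \sum_g expR (l * (f g - fmean f)) <= #|G|%:R * expR (l ^+ 2 * fmean f).
Proof.
move=> hf hl; set u := fmean f.
have G0' : 0 < #|G|%:R :> R by rewrite ltr0n.
have sumf : \sum_g f g = #|G|%:R * u by rewrite /u /fmean mulVKf ?gt_eqF.
have u01 : 0 <= u <= 1.
  rewrite -(ler_pM2l G0') -(ler_pM2l G0' u) mulr0 mulr1 -sumf.
  rewrite sumr_ge0 => [|g _]; last by case/andP: (hf g).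
  rewrite -sum1_card natr_sum; apply: ler_sum => g _; by case/andP: (hf g).
apply: (@le_trans _ _ (\sum_g (1 + l * (f g - u) + l ^+ 2 * (f g - 2 * u * f g + u ^+ 2)))).
  apply: ler_sum => g _; apply: le_trans (expR_le_quadratic _) _.
    apply: le_trans (ler_norm _) _; rewrite normrM -[leRHS]mulr1.
    apply: ler_pM => //; case/andP: (hf g) => ? ?; case/andP: u01 => ? ?.
    by rewrite ler_norml; apply/andP; split; lra.
  rewrite lerD2l exprMn ler_wpM2l ?sqr_ge0 //.
  have : 0 <= f g * (1 - f g) by case/andP: (hf g) => ? ?; rewrite mulr_ge0 ?subr_ge0.
  rewrite !expr2; lra.
rewrite (eq_bigr (fun g => (1 - l * u + l ^+ 2 * u ^+ 2) +
  (l + l ^+ 2 - 2 * l ^+ 2 * u) * f g)); last by move=> g _; ring.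
rewrite big_split /= -mulr_sumr sumr_const sumf -[X in X + _ <= _]mulr_natl.
apply: (@le_trans _ _ (#|G|%:R * (1 + l ^+ 2 * u))); last first.
  by rewrite ler_pM2l // expR_ge1Dx.
have : 0 <= #|G|%:R * (l * u) ^+ 2 by rewrite mulr_ge0 ?sqr_ge0.
by rewrite !expr2; lra.
Qed.

Lemma exp_moment_iid (N : nat) f (l : R) :
  (forall g, 0 <= f g <= 1) -> `|l| <= 3^-1 ->
  \sum_(x : {ffun 'I_N -> G}) expR (l * (\sum_n f (x n) - N%:R * fmean f))
    <= #|G|%:R ^+ N * expR (N%:R * (l ^+ 2 * fmean f)).
Proof.
move=> hf hl.
have -> : \sum_(x : {ffun 'I_N -> G}) expR (l * (\sum_n f (x n) - N%:R * fmean f)) =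
    (\sum_g expR (l * (f g - fmean f))) ^+ N.
  rewrite -[N in RHS]card_ord -prodr_const bigA_distr_bigA /=.
  apply: eq_bigr => x _; rewrite -expR_sum -mulr_sumr sumrB.
  by rewrite sumr_const card_ord mulr_natl.
rewrite expRM_natl -exprMn lerXn2r ?nnegrE ?mulr_ge0 ?expR_ge0 ?exp_moment //.
by rewrite sumr_ge0 // => g _; apply: expR_ge0.
Qed.

(** A union bound by averaging: the two-sided exponential moments [Phi] have mean below 1, so some
    sample has [Phi x < 1], which bounds every exponent at once. *)
Lemma good_sample (E : eqType) (s : seq E) (N : nat) (f : E -> G -> R)
    (l X dev : E -> R) :
  (0 < N)%N ->
  (forall e g, e \in s -> 0 <= f e g <= 1) ->
  (forall e, e \in s -> 0 < l e <= 3^-1) ->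
  (forall e, e \in s ->
     N%:R * (l e ^+ 2 * fmean (f e)) + X e <= N%:R * (l e * dev e)) ->
  \sum_(e <- s) 2 * expR (- X e) < 1 ->
  exists x : 'I_N -> G, forall e, e \in s ->
    `|N%:R^-1 * \sum_n f e (x n) - fmean (f e)| <= dev e.
Proof.
move=> N0 hf hl hdev hsum.
have N0' : 0 < N%:R :> R by rewrite ltr0n.
pose D (x : {ffun 'I_N -> G}) e := \sum_n f e (x n) - N%:R * fmean (f e).
pose w e := N%:R * (l e * dev e).
pose Phi x := \sum_(e <- s) (expR (l e * D x e) + expR (- l e * D x e)) * expR (- w e).
have Phi_le : \sum_x Phi x <= #|G|%:R ^+ N * \sum_(e <- s) 2 * expR (- X e).
  rewrite /Phi exchange_big /= mulr_sumr big_seq [leRHS]big_seq.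
  apply: ler_sum => e es; rewrite -mulr_suml big_split /=.
  have hfe g := hf e g es; have /andP[l0 l3] := hl e es.
  have le : `|l e| <= 3^-1 by rewrite ger0_norm // ltW.
  have h1 := exp_moment_iid N hfe le.
  have h2 : _ := @exp_moment_iid N _ (- l e) hfe; rewrite normrN sqrrN in h2.
  have {}h2 := h2 le.
  set a := #|G|%:R ^+ N in h1 h2 *; set b := expR (N%:R * _) in h1 h2.
  apply: (@le_trans _ _ ((a * b + a * b) * expR (- w e))).
    by rewrite ler_wpM2r ?expR_ge0 // lerD.
  have -> : (a * b + a * b) * expR (- w e) = a * (2 * (b * expR (- w e))) by ring.
  rewrite ler_wpM2l ?exprn_ge0 // ler_wpM2l // /b -expRD ler_expR.
  by have := hdev e es; rewrite -/(w e); lra.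
have [x hx] : exists x, Phi x < 1.
  apply: contrapT => nex.
  have h x : 1 <= Phi x by rewrite leNgt; apply/negP => hx; apply: nex; exists x.
  have : #|G|%:R ^+ N <= \sum_x Phi x.
    have -> : #|G|%:R ^+ N = \sum_(x : {ffun 'I_N -> G}) 1 :> R.
      by rewrite sumr_const card_ffun card_ord natrX.
    by apply: ler_sum.
  move=> /le_trans /(_ Phi_le); rewrite leNgt => /negP; apply.
  by rewrite -[ltRHS]mulr1 ltr_pM2l // exprn_gt0 // ltr0n.
exists x => e es; have /andP[l0 l3] := hl e es.
have term : (expR (l e * D x e) + expR (- l e * D x e)) * expR (- w e) < 1.
  apply: le_lt_trans hx; rewrite /Phi (big_rem e) //= lerDl.
  by rewrite sumr_ge0 // => e' _; rewrite mulr_ge0 ?addr_ge0 ?expR_ge0.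
have lim a b : (expR a + expR b) * expR (- w e) < 1 -> a <= w e.
  move=> h; rewrite -subr_le0 -ler_expR expR0; apply/ltW; apply: le_lt_trans h.
  by rewrite mulrDl expRD lerDl mulr_ge0 ?expR_ge0.
have h1 := lim _ _ term; rewrite addrC in term; have h2 := lim _ _ term.
have -> : N%:R^-1 * \sum_n f e (x n) - fmean (f e) = N%:R^-1 * D x e.
  by rewrite /D mulrBr mulKf ?gt_eqF.
rewrite normrM ger0_norm ?invr_ge0 // ler_pdivrMl //.
have {}h1 : l e * D x e <= l e * (N%:R * dev e) by rewrite /w in h1; lra.
have {}h2 : l e * - D x e <= l e * (N%:R * dev e) by rewrite /w in h2; lra.
rewrite ler_pM2l // in h1; rewrite ler_pM2l // in h2.
by rewrite ler_norml; apply/andP; split; lra.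
Qed.

End Sampling.

(** * Chaining *)

Lemma box_vol_le (R : realType) (d : nat) (y z : 'rV[R]_d) :
  closed_cube y -> (forall j, y 0 j <= z 0 j) -> box_vol y <= box_vol z.
Proof.
by move=> hy hyz; apply: ler_prod => j _; rewrite hyz andbT; case/andP: (hy j).
Qed.

Lemma indic_box_le (R : realType) (d : nat) (x y z : 'rV[R]_d) :
  (forall j, y 0 j <= z 0 j) ->
  \1_(anchored_box y) x <= \1_(anchored_box z) x :> R.
Proof.
move=> hyz; rewrite !indicE ler_nat; case: (boolP (x \in anchored_box y)) => //.
rewrite inE => h; rewrite mem_set // => j.
by case/andP: (h j) => -> /= /lt_le_trans; apply.
Qed.

(** The corners of a bracketing cover with [delta = 4^-k]. Level 0 is the origin alone, whose empty
    box starts the chain with no deviation; hence upper neighbours only for [k > 0]. *)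
Lemma dyadic_net (R : realType) (d k : nat) : (0 < d)%N ->
  exists V : seq 'rV[R]_d,
  [/\ k = 0%N -> V = [:: 0],
      (0 < k)%N -> (size V)%:R <= 64 ^+ (k * d) :> R,
      forall v, v \in V -> closed_cube v,
      forall y, closed_cube y -> exists l,
        [/\ l \in V, forall j, l 0 j <= y 0 j & box_vol y - box_vol l <= 4 ^- k] &
      forall y, closed_cube y -> (0 < k)%N -> exists u,
        [/\ u \in V, forall j, y 0 j <= u 0 j & box_vol u - box_vol y <= 4 ^- k]].
Proof.
move=> d0; case: (posnP k) => [->|k0].
  exists [:: 0]; split=> // [v|y hy].
    by rewrite inE => /eqP ->; apply: closed_cube0.
  exists 0; rewrite inE eqxx; split=> // [j|]; first by rewrite mxE; case/andP: (hy j).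
  have /andP[_ h1] := box_vol01 hy.
  have /andP[h2 _] := box_vol01 (@closed_cube0 R d).
  by rewrite expr0 invr1; lra.
have h4 : 4 <= 4 ^+ k :> R by rewrite -[leLHS]expr1 ler_weXn2l // ler1n.
have e4 : 0 < (4 ^- k : R) <= 2^-1.
  by rewrite invr_gt0 exprn_gt0 //= lef_pV2 ?posrE ?exprn_gt0 //; lra.
have [s [hs scube scov]] := bracketing_cover d0 e4.
exists ([seq b.1 | b <- s] ++ [seq b.2 | b <- s]); split.
- by move=> k0'; rewrite k0' in k0.
(* [2 (2 * 16^k)^d <= (4 * 16^k)^d <= 64^(k d)]. *)
- move=> _; rewrite size_cat !size_map addnn -mul2n natrM.
  apply: (@le_trans _ _ (2 ^+ d * (2 / (4 ^- k) ^+ 2) ^+ d)).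
    by apply: ler_pM => //; rewrite -[leLHS]expr1 ler_weXn2l // ler1n.
  rewrite -exprMn exprM.
  have -> : 64 ^+ k = 4 ^+ k * 4 ^+ k * 4 ^+ k :> R.
    by rewrite -!exprMn; congr (_ ^+ _); ring.
  move: h4; set P := 4 ^+ k => h4.
  have -> : 2 * (2 / P^-1 ^+ 2) = 4 * (P * P) by field; lra.
  have P0 : 0 <= P * P by apply: mulr_ge0; lra.
  have PP : 4 * (P * P) <= P * P * P by rewrite -[leRHS]mulrA ler_wpM2r.
  by apply: lerXn2r => //; rewrite nnegrE; lra.
- move=> v; rewrite mem_cat => /orP[] /mapP[b /scube[h1 h2 _] ->] //.
- move=> y hy; have [b bs hb] := scov y hy; exists b.1.
  have [h1 h2 h3] := scube b bs; split.
  + by rewrite mem_cat map_f.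
  + by move=> j; case/andP: (hb j).
  apply: le_trans h3; rewrite lerD2r box_vol_le // => j; by case/andP: (hb j).
move=> y hy _; have [b bs hb] := scov y hy; exists b.2.
have [h1 h2 h3] := scube b bs; split.
+ by rewrite mem_cat map_f ?orbT.
+ by move=> j; case/andP: (hb j).
apply: le_trans h3; rewrite lerD2l lerN2 box_vol_le // => j; by case/andP: (hb j).
Qed.

Lemma expR_le_exp2N (R : realType) (n : nat) : expR (- n%:R) <= 2 ^- n :> R.
Proof.
rewrite expRN lef_pV2 ?posrE ?expR_gt0 ?exprn_gt0 // -[n%:R]mulr1 expRM_natl.
by rewrite lerXn2r ?nnegrE ?expR_ge0 // (le_trans _ (expR_ge1Dx 1)).
Qed.

Lemma sum_exp4 (R : realFieldType) (K : nat) :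
  \sum_(1 <= k < K.+1) 2 * 4 ^- k < 1 :> R.
Proof.
suff -> : \sum_(1 <= k < K.+1) 2 * 4 ^- k = 2 / 3 * (1 - 4 ^- K) :> R.
  have : 0 < 4 ^- K :> R by rewrite invr_gt0 exprn_gt0.
  lra.
elim: K => [|K IH]; first by rewrite big_geq // expr0 invr1; ring.
rewrite big_nat_recr //= IH exprS invfM; field; by rewrite expf_neq0.
Qed.

(** For the least [K] with [4^-K <= eps/4], minimality gives [eps 4^K <= 16], hence
    [(eps 2^K)^2 <= 16]; this keeps the exponential parameters of the chaining below [1/3]. *)
Lemma dyadic_level (R : realType) (eps : R) : 0 < eps < 1 ->
  exists K, [/\ (0 < K)%N, 4 ^- K <= eps / 4 & eps * 2 ^+ K <= 4].
Proof.
case/andP => e0 e1.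
have ex : exists n, 4 ^- n <= eps / 4.
  have [||n hn] := @exists_expr_le R 4^-1 (eps / 4); [lra|lra|].
  by exists n; rewrite -exprVn.
case: (ex_minnP ex) => K hK Kmin.
have K0 : (0 < K)%N.
  by rewrite lt0n; apply/eqP => K0; move: hK; rewrite K0 expr0 invr1; lra.
exists K; split=> //.
have : eps / 4 < 4 ^- K.-1.
  by rewrite ltNge; apply/negP => /Kmin; rewrite leqNgt ltn_predL K0.
have p4 : 0 < 4 ^+ K.-1 :> R by rewrite exprn_gt0.
rewrite -[ltRHS]mul1r ltr_pdivlMr // => h.
have hK4 : eps * 4 ^+ K <= 16 by rewrite -(prednK K0) exprS; lra.
have p2 : 0 <= 2 ^+ K :> R by rewrite exprn_ge0.
rewrite -(@ler_pXn2r _ 2) ?nnegrE ?mulr_ge0 ?(ltW e0) //.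
have -> : (eps * 2 ^+ K) ^+ 2 = eps * (eps * 4 ^+ K).
  have -> : 4 ^+ K = 2 ^+ K * 2 ^+ K :> R by rewrite -exprMn; congr (_ ^+ _); ring.
  ring.
apply: (@le_trans _ _ (1 * (eps * 4 ^+ K))).
  by rewrite ler_wpM2r ?(ltW e1) // mulr_ge0 ?exprn_ge0 ?(ltW e0).
by rewrite mul1r expr2; lra.
Qed.

Lemma small_discrepancy_points (R : realType) (d N : nat) (eps : R) :
  (0 < d)%N -> 0 < eps < 1 -> 1536 * d%:R <= N%:R * eps ^+ 2 ->
  exists x : 'I_N -> 'rV[R]_d,
    (forall n, halfopen_cube (x n)) /\ star_discrepancy x <= eps.
Proof.
move=> d0 heps hN; have /andP[e0 e1] := heps.
have [K [K0 K4 K2]] := dyadic_level heps.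
have [V hV] := choice (fun k => dyadic_net R k d0).
have low_ex k : exists low : 'rV[R]_d -> 'rV[R]_d,
    forall y, closed_cube y -> [/\ low y \in V k,
      forall j, low y 0 j <= y 0 j & box_vol y - box_vol (low y) <= 4 ^- k].
  suff h : forall y : 'rV[R]_d, exists l, closed_cube y -> [/\ l \in V k,
      forall j, l 0 j <= y 0 j & box_vol y - box_vol l <= 4 ^- k].
    by have [low hlow] := choice h; exists low.
  move=> y; have [hy|hy] := pselect (closed_cube y); last by exists y.
  by have [_ _ _ h _] := hV k; have [l hl] := h y hy; exists l.
have [low hlow] := choice low_ex.
have Vcube k v : v \in V k -> closed_cube v by have [_ _ h _ _] := hV k; apply: h.
pose eta : R := 4 ^- K.
have eta0 : 0 < eta by rewrite invr_gt0 exprn_gt0.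
have [m [m0 hm]] : exists m, (0 < m)%N /\ d%:R / m%:R <= eta.
  exists (d * 4 ^ K)%N; rewrite muln_gt0 d0 expn_gt0; split=> //.
  by rewrite natrM natrX invfM mulrA divff ?mul1r // pnatr_eq0 -lt0n.
pose G := {ffun 'I_d -> 'I_m}.
have G0 : (0 < #|{: G}|)%N by rewrite card_ffun !card_ord expn_gt0 m0.
pose ind (v : 'rV[R]_d) (g : G) : R := \1_(anchored_box v) (grid_point R g).
pose mu v := fmean (ind v).
have hmu v : closed_cube v -> `|mu v - box_vol v| <= eta.
  by move=> hv; apply: le_trans hm; apply: grid_freq.
(* A chain link: a box of one level minus its lower approximant one level coarser. *)
pose f (a : nat * 'rV[R]_d) g := ind a.2 g - ind (low a.1.-1 a.2) g.
have fmeanf a : fmean (f a) = mu a.2 - mu (low a.1.-1 a.2).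
  by rewrite /mu /fmean -mulrBr -sumrB.
pose E := [seq (k, v) | k <- index_iota 1 K.+1, v <- V k].
have inE' a : a \in E -> [/\ (0 < a.1)%N, (a.1 <= K)%N & a.2 \in V a.1].
  case/allpairsPdep => k [v [hk hv ->]] /=; move: hk.
  by rewrite mem_index_iota ltnS => /andP[].
(* [lam], [X] and [dev] are the exponential parameter, the union-bound exponent
   and the tolerated deviation: [X] beats the [64 ^ (k * d)] events of level [k]
   (their mean is at most [6 * 4 ^- k]), and [\sum_k dev k <= eps / 2]. *)
pose lam (a : nat * 'rV[R]_d) : R := eps * 2 ^+ a.1 / 24.
pose X (a : nat * 'rV[R]_d) : R := (8 * (a.1 * d))%:R.
pose dev (k : nat) : R := eps / 8 * ((k + 2)%:R / 2 ^+ k).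
have N0 : (0 < N)%N.
  rewrite lt0n; apply/eqP => N0; move: hN; rewrite N0 mul0r.
  by have : 0 < d%:R :> R by [rewrite ltr0n]; lra.
have [x hx] : exists x : 'I_N -> G, forall a, a \in E ->
    `|N%:R^-1 * \sum_n f a (x n) - fmean (f a)| <= dev a.1.
  apply: (@good_sample _ _ G0 _ E N f lam X (fun a => dev a.1)) => //.
  - move=> a g /inE'[_ _ aV].
    have [_ hl _] := hlow a.1.-1 a.2 (Vcube _ _ aV).
    rewrite subr_ge0 indic_box_le //= /f lerBlDr.
    apply: (@le_trans _ _ 1); first by rewrite /ind indicE; case: (_ \in _).
    by rewrite lerDl /ind indicE.
  - move=> a /inE'[_ aK _]; rewrite /lam; apply/andP; split.
      by rewrite divr_gt0 // mulr_gt0 // exprn_gt0.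
    have : eps * 2 ^+ a.1 <= eps * 2 ^+ K by rewrite ler_pM2l // ler_weXn2l // ler1n.
    lra.
  - move=> a /inE'[a0 aK aV]; rewrite fmeanf /lam /X /dev; set k := a.1 in a0 aK aV *.
    have hv := Vcube _ _ aV; have [lV ll lvol] := hlow k.-1 a.2 hv.
    have := hmu _ hv; have := hmu _ (Vcube _ _ lV); rewrite !ler_norml.
    set P : R := 2 ^+ k; have P0 : 0 < P by rewrite exprn_gt0.
    have P4 : 4 ^- k = P^-1 * P^-1 :> R.
      by rewrite -invfM -exprMn; congr (_ ^- _); ring.
    have etak : eta <= P^-1 * P^-1.
      by rewrite -P4 lef_pV2 ?posrE ?exprn_gt0 // ler_weXn2l // ler1n.
    have k4 : 4 ^- k.-1 = 4 * (P^-1 * P^-1) :> R.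
      rewrite -P4 -{2}(prednK a0) exprS invfM mulVKf //; lra.
    rewrite k4 in lvol.
    move=> /andP[? ?] /andP[? ?].
    (* [6 = 4 + 2]: the volume gap [4^-(k-1)] and two grid errors of at most [4^-k]. *)
    have hmean : mu a.2 - mu (low k.-1 a.2) <= 6 * (P^-1 * P^-1) by lra.
    apply: (@le_trans _ _
      (N%:R * ((eps * P / 24) ^+ 2 * (6 * (P^-1 * P^-1))) + (8 * (k * d))%:R)).
      by rewrite lerD2r ler_wpM2l // ler_wpM2l // sqr_ge0.
    have -> : N%:R * ((eps * P / 24) ^+ 2 * (6 * (P^-1 * P^-1))) = N%:R * eps ^+ 2 / 96 :> R.
      by field; lra.
    (* The summand 2 in [k + 2] pays for the variance, and [k] for [X], as [1536 = 8 * 192]. *)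
    have -> : N%:R * (eps * P / 24 * (eps / 8 * ((k + 2)%:R / P))) =
       N%:R * eps ^+ 2 / 96 + N%:R * eps ^+ 2 * k%:R / 192 :> R.
      by rewrite natrD; field; lra.
    rewrite lerD2l !natrM.
    have : 1536 * d%:R * k%:R <= N%:R * eps ^+ 2 * k%:R :> R by rewrite ler_wpM2r.
    lra.
  (* Level [k] contributes at most [64^(kd) * 2 * 256^(-kd) <= 2 * 4^-k]. *)
  rewrite big_allpairs_dep; apply: le_lt_trans (sum_exp4 R K).
  rewrite big_nat_cond [leRHS]big_nat_cond; apply: ler_sum => k; rewrite andbT => /andP[k0 _].
  rewrite /X /= big_const_seq count_predT iter_addr_0 -[leLHS]mulr_natl.
  have [_ hs _ _ _] := hV k; have {}hs := hs k0.
  set n := (k * d)%N in hs *.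
  apply: (@le_trans _ _ (64 ^+ n * (2 * 2 ^- (8 * n)))).
    by apply: ler_pM; rewrite ?mulr_ge0 ?expR_ge0 // ler_wpM2l // expR_le_exp2N.
  have -> : 64 ^+ n * (2 * 2 ^- (8 * n)) = 2 * 4 ^- n :> R.
    have -> : 2 ^+ (8 * n) = 64 ^+ n * 4 ^+ n :> R.
      by rewrite exprM -exprMn; congr (_ ^+ _); ring.
    by field; rewrite !expf_neq0.
  by rewrite ler_wpM2l // lef_pV2 ?posrE ?exprn_gt0 // ler_weXn2l ?ler1n // leq_pmulr.
exists (fun n => grid_point R (x n)); split=> [n|]; first exact: grid_point_cube.
set pts := fun n => _; pose D v := box_freq pts v - mu v.
(* The bound is the sum of [dev i] over [1 <= i <= k], from [(i + 2)/2^i] summing to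
   [4 - (k + 4)/2^k]. *)
have hD k v : (k <= K)%N -> v \in V k ->
    `|D v| <= eps / 8 * (4 - (k + 4)%:R / 2 ^+ k).
  elim: k v => [|k IH] v kK vV.
    have [V0 _ _ _ _] := hV 0%N; move: vV; rewrite V0 // inE => /eqP ->.
    have z g : ind 0 g = 0.
      rewrite /ind indicE memNset // => /(_ (Ordinal d0)).
      by rewrite !mxE => /andP[/le_lt_trans h /h]; rewrite ltxx.
    have -> : D 0 = 0.
      by rewrite /D /mu /fmean /box_freq !big1 ?mulr0 ?subrr // => n _; apply: z.
    by rewrite normr0 mulr_ge0 ?divr_ge0 ?(ltW e0) //; lra.
  have [lV ll lvol] := hlow k v (Vcube _ _ vV).
  have h1 := IH _ (ltnW kK) lV.
  have : (k.+1, v) \in E.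
    by apply/allpairsPdep; exists k.+1, v; rewrite mem_index_iota ltnS.
  move=> /hx; rewrite fmeanf /= => h2.
  have -> : D v = D (low k v) + (N%:R^-1 * \sum_n f (k.+1, v) (x n) - (mu v - mu (low k v))).
    by rewrite /D /box_freq /f /= sumrB mulrBr; ring.
  apply: le_trans (ler_normD _ _) _; apply: le_trans (lerD h1 h2) _.
  rewrite /dev -mulrDr ler_wpM2l ?divr_ge0 ?(ltW e0) // exprS !natrD -!natr1.
  have p0 : 2 ^+ k != 0 :> R by rewrite expf_neq0.
  rewrite le_eqVlt; apply/orP; left; apply/eqP; by field.
have hDK v : v \in V K -> `|D v| <= eps / 2.
  move=> /(hD K v (leqnn K)) /le_trans; apply.
  have : 0 <= eps / 8 * ((K + 4)%:R / 2 ^+ K).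
    by rewrite mulr_ge0 ?divr_ge0 ?exprn_ge0 ?(ltW e0).
  lra.
(* Between its level-[K] neighbours the error at [y] is at most [eps/2] from the chain plus [eps/4]
   each from the grid and the bracket. *)
apply: star_discrepancy_le => y hy.
have [lV ll lvol] := hlow K y hy.
have [_ _ _ _ /(_ y hy K0) [u [uV yu uvol]]] := hV K.
have freq_le (v w : 'rV[R]_d) : (forall j, v 0 j <= w 0 j) -> box_freq pts v <= box_freq pts w.
  by move=> vw; rewrite ler_wpM2l ?invr_ge0 //; apply: ler_sum => n _; apply: indic_box_le.
have := freq_le _ _ ll; have := freq_le _ _ yu.
have := hDK _ lV; have := hDK _ uV; have := hmu _ (Vcube _ _ lV); have := hmu _ (Vcube _ _ uV).
rewrite -/eta in lvol uvol; rewrite -/eta in K4.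
rewrite /D !ler_norml => /andP[? ?] /andP[? ?] /andP[? ?] /andP[? ?] ? ?.
by apply/andP; split; lra.
Qed.

(** * The upper bound for the inverse and the values of the exponents *)

Lemma inverse_star_discrepancy_upper (R : realType) (d : nat) (eps : R) :
  (0 < d)%N -> 0 < eps < 1 ->
  (inverse_star_discrepancy d eps <= (1537 * d%:R * eps ^- 2)%:E)%E.
Proof.
move=> d0 heps; have /andP[e0 e1] := heps.
pose t : R := d%:R * eps ^- 2.
have d1 : 1 <= d%:R :> R by rewrite ler1n.
have e2 : 0 < eps ^+ 2 by rewrite exprn_gt0.
have t1 : 1 <= t.
  by rewrite /t -[leLHS]mulr1; apply: ler_pM => //; rewrite invf_ge1 // exprn_ile1 ?ltW.
(* Rounding up costs at most 1, which [t >= 1] absorbs; hence [1537]. *)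
have [N [N0 hN hN']] : exists N, [/\ (0 < N)%N, 1536 * t <= N%:R & N%:R <= 1536 * t + 1].
  have : 0 <= 1536 * t by lra.
  move: (1536 * t) => r /truncn_itv /andP[h1 h2].
  by exists (Num.truncn r).+1; rewrite (ltW h2) -natr1 lerD2r.
have hNe : 1536 * d%:R <= N%:R * eps ^+ 2 by rewrite -ler_pdivrMr // -mulrA.
have [x [hx hD]] := small_discrepancy_points d0 heps hNe.
apply: le_trans (inverse_star_discrepancy_le _ (min_star_discrepancy_le hx hD)) _ => //.
by rewrite lee_fin -mulrA -/t; lra.
Qed.

Lemma inverse_bound_upper (R : realType) : inverse_bound 1537 2 1 (2^-1 : R).
Proof.
move=> d eps d0 /andP[e0 e2].
have heps : 0 < eps < 1 by rewrite e0 /=; lra.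
apply: le_trans (inverse_star_discrepancy_upper d0 heps) _.
by rewrite powRr1 // powRN (powR_mulrn _ (ltW e0)) lexx.
Qed.

Local Open Scope classical_set_scope.

Theorem theorem1p2 (R : realType) :
  [/\ accuracy_exponent R = 2,
      dimension_exponent R = 1,
      exists C : R, 0 < C /\
        forall (d : nat) (eps : R), (0 < d)%N -> 0 < eps < 1 ->
          (inverse_star_discrepancy d eps <= (C * d%:R * eps ^- 2)%:E)%E &
      forall C p q eps1 : R,
        0 < C -> 0 <= p -> 0 <= q -> 0 < eps1 ->
        inverse_bound C p q eps1 -> 2 <= p /\ 1 <= q].
Proof.
have C0 : 0 < 1537 :> R by rewrite ltr0n.
have h0 : 0 < 2^-1 :> R by rewrite invr_gt0 ltr0n.
have ub := @inverse_bound_upper R.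
split.
- pose S := [set p : R | 0 <= p /\ exists C q eps1 : R,
    [/\ 0 < C, 0 <= q, 0 < eps1 & inverse_bound C p q eps1]].
  have S2 : S 2 by split=> //; exists 1537, 1, 2^-1.
  have lbS : lbound S 2.
    by move=> p [p0 [C [q [e [? ? e0 hb]]]]]; apply: inverse_bound_ge2 e0 hb.
  apply/le_anti/andP; split; first by apply: ge_inf => //; exists 2.
  by apply: lb_le_inf => //; exists 2.
- pose S := [set q : R | 0 <= q /\ exists C p eps1 : R,
    [/\ 0 < C, 0 <= p, 0 < eps1 & inverse_bound C p q eps1]].
  have S1 : S 1 by split=> //; exists 1537, 2, 2^-1.
  have lbS : lbound S 1.
    by move=> q [q0 [C [p [e [c0 ? e0 hb]]]]]; apply: inverse_bound_ge1 c0 e0 hb.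
  apply/le_anti/andP; split; first by apply: ge_inf => //; exists 1.
  by apply: lb_le_inf => //; exists 1.
- by exists 1537; split=> // d eps; apply: inverse_star_discrepancy_upper.
move=> C p q eps1 c0 _ _ e0 hb; split.
  exact: inverse_bound_ge2 e0 hb.
exact: inverse_bound_ge1 c0 e0 hb.
Qed.
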